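(* Let $\Sigma=(X,\sigma)$ be a singly generated dynamical system. For every $(x_0,\gamma_0)\in X\times\mathbb{T}$, the representation $\pi_{(x_0,\gamma_0)}\colon C^*(\Sigma)\to B(H_{x_0})$ is irreducible.
   Context: Singly generated dynamical system (SGDS): a pair $\Sigma=(X,\sigma)$ where $X$ is a locally compact Hausdorff space (not assumed second countable) and $\sigma\colon U\to X$ is a local homeomorphism defined on an open subset $U\subset X$. $\mathbb{N}=\{0,1,2,\dots\}$; $\mathbb{T}$ is the unit circle in $\mathbb{C}$. Put $U_0=X$, $U_1=U$, $U_{n+1}=\{x\in U_n\mid \sigma^n(x)\in U\}$; $U_n$ is the domain of $\sigma^n$, and whenever $\sigma^n(x)$ is written it is implicitly assumed that $x\in U_n$. The algebra $C^*(\Sigma)$: for $\xi,\eta\in C_c(U)$ define $\langle\xi,\eta\rangle\in C_c(X)$ by $\langle\xi,\eta\rangle(x)=\sum_{\sigma(y)=x}\overline{\xi(y)}\eta(y)$. $C^*(\Sigma)$ is the universal $C^*$-algebra generated by the images of a $*$-homomorphism $t^0\colon C_0(X)\to C^*(\Sigma)$ and a linear map $t^1\colon C_c(U)\to C^*(\Sigma)$ satisfying (i) $t^1(\xi)^*t^1(\eta)=t^0(\langle\xi,\eta\rangle)$ for $\xi,\eta\in C_c(U)$; (ii) $t^1(\xi)t^1(\eta)^*=t^0(\xi\overline{\eta})$ for $\xi,\eta\in C_c(V)$ whenever $V\subset U$ is open and $\sigma|_V$ is injective. Representations: for $x_0\in X$, $\mathrm{Orb}(x_0)=\{x\in X\mid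 \sigma^n(x)=\sigma^m(x_0)\text{ for some }n,m\in\mathbb{N}\}$, and $H_{x_0}$ is the Hilbert space with orthonormal basis $\{\delta_x\}_{x\in\mathrm{Orb}(x_0)}$. For $(x_0,\gamma_0)\in X\times\mathbb{T}$, $\pi_{(x_0,\gamma_0)}\colon C^*(\Sigma)\to B(H_{x_0})$ is the $*$-homomorphism determined (via the universal property) by $\pi_{(x_0,\gamma_0)}(t^0(f))\delta_x=f(x)\delta_x$ and $\pi_{(x_0,\gamma_0)}(t^1(\xi))\delta_x=\gamma_0\sum_{\sigma(y)=x}\xi(y)\delta_y$ for $f\in C_0(X)$, $\xi\in C_c(U)$, $x\in\mathrm{Orb}(x_0)$. *)

(* Defs.v *)
From HB Require Import structures.
From mathcomp Require Import all_boot all_order all_algebra.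
From mathcomp Require Import complex.
From mathcomp Require Import all_classical all_reals all_analysis.
Set Implicit Arguments.
Unset Strict Implicit.
Unset Printing Implicit Defensive.
Import Order.TTheory GRing.Theory Num.Theory.
Import numFieldNormedType.Exports.
Local Open Scope classical_set_scope.
Local Open Scope ring_scope.

(* The complex numbers, typed as a numClosedFieldType so that the topology and
   norm that numFieldNormedType puts on every numFieldType apply to them. The
   norm is C-valued (with values in the nonnegative reals). *)
Definition C (R : realType) : numClosedFieldType := complex R.

(* C*-algebras, not necessarily unital; the product is cmul because the ring
   structures of MathComp are all unital. *)
HB.mixin Record isCStarAlgebra (R : realType) A
    of CompleteNormedModule (C R) A := {
  cmul : A -> A -> A ;
  star : A -> A ;
  cmulA : associative cmul ;
  cmulDl : left_distributive cmul +%R ;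
  cmulDr : right_distributive cmul +%R ;
  cmulZl : forall (k : C R) (a b : A), cmul (k *: a) b = k *: cmul a b ;
  cmulZr : forall (k : C R) (a b : A), cmul a (k *: b) = k *: cmul a b ;
  starK : involutive star ;
  starD : {morph star : a b / a + b} ;
  starZ : forall (k : C R) (a : A), star (k *: a) = k^* *: star a ;
  starM : forall a b : A, star (cmul a b) = cmul (star b) (star a) ;
  norm_cmul_le : forall a b : A, `|cmul a b| <= `|a| * `|b| ;
  norm_star_cmul : forall a : A, `|cmul (star a) a| = `|a| ^+ 2
}.

#[short(type="cstarAlgType")]
HB.structure Definition CStarAlgebra (R : realType) :=
  {A of CompleteNormedModule (C R) A & isCStarAlgebra R A}.

(* The inner product is linear in its first argument. *)
HB.mixin Record isHilbert (R : realType) H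
    of CompleteNormedModule (C R) H := {
  hdot : {dot H for (@Num.conj (C R))} ;
  hdot_norm : forall v : H, hdot v v = `|v| ^+ 2
}.

#[short(type="hilbertType")]
HB.structure Definition Hilbert (R : realType) :=
  {H of CompleteNormedModule (C R) H & isHilbert R H}.

Definition lin_subspace (K : fieldType) (V : lmodType K) (W : set V) : Prop :=
  W 0 /\ forall (k : K) (u v : V), W u -> W v -> W (k *: u + v).

Definition lin_span (T : choiceType) (K : fieldType) (V : lmodType K)
    (D : set T) (e : T -> V) : set V :=
  [set v | exists (s : seq T) (c : T -> K),
    (forall x, x \in s -> D x) /\ v = \sum_(x <- s) c x *: e x].

(* The family e restricted to D is an orthonormal basis of H; the values of e
   outside D are irrelevant. *)
Definition orthonormal_basis (R : realType) (H : hilbertType R)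
    (T : choiceType) (D : set T) (e : T -> H) : Prop :=
  (forall x y, D x -> D y -> hdot (e x) (e y) = (x == y)%:R) /\
  closure (lin_span D e) = [set: H].

Section MorphismsAndRepresentations.
Variable R : realType.

Record star_morphism (A B : cstarAlgType R) (phi : A -> B) : Prop := {
  morphism_linear : forall (k : C R) (a b : A),
    phi (k *: a + b) = k *: phi a + phi b ;
  morphism_mul : forall a b : A, phi (cmul a b) = cmul (phi a) (phi b) ;
  morphism_star : forall a : A, phi (star a) = star (phi a)
}.

(* A *-homomorphism from A to the algebra B(H) of bounded operators. *)
Record star_representation (A : cstarAlgType R) (H : hilbertType R)
    (pi : A -> {linear H -> H}) : Prop := {
  rep_bounded : forall a : A, continuous (pi a : H -> H) ;
  rep_linear : forall (k : C R) (a b : A) (v : H),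
    pi (k *: a + b) v = k *: pi a v + pi b v ;
  rep_mul : forall (a b : A) (v : H), pi (cmul a b) v = pi a (pi b v) ;
  rep_star : forall (a : A) (v w : H),
    hdot (pi (star a) v) w = hdot v (pi a w)
}.

Definition irreducible (A : cstarAlgType R) (H : hilbertType R)
    (pi : A -> {linear H -> H}) : Prop :=
  (exists (a : A) (v : H), pi a v <> 0) /\
  forall W : set H, lin_subspace W -> closed W ->
    (forall (a : A) (v : H), W v -> W (pi a v)) ->
    W = [set 0] \/ W = [set: H].

Definition generated_by (A : cstarAlgType R) (G : set A) : Prop :=
  forall B : set A, lin_subspace B -> closed B ->
    (forall a b, B a -> B b -> B (cmul a b)) ->
    (forall a, B a -> B (star a)) ->
    G `<=` B -> B = [set: A].

End MorphismsAndRepresentations.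

Definition local_homeomorphism_on (X : topologicalType) (U : set X)
    (f : X -> X) : Prop :=
  forall x, U x -> exists (V : set X) (g : X -> X),
    [/\ open V /\ V x, V `<=` U, open (f @` V),
        {within V, continuous f} /\ {within f @` V, continuous g} &
        forall y, V y -> g (f y) = y].

(* sigma is a total function whose values outside dom carry no information. *)
Record sgds := SGDS {
  space :> topologicalType ;
  space_hausdorff : hausdorff_space space ;
  space_locally_compact : locally_compact [set: space] ;
  dom : set space ;
  dom_open : open dom ;
  sigma : space -> space ;
  sigma_local_homeo : local_homeomorphism_on dom sigma
}.

Section SGDSTheory.
Variables (R : realType) (S : sgds).

Fixpoint iter_dom (n : nat) : set S :=
  if n is m.+1 then iter_dom m `&` [set x | dom (iter m (@sigma S) x)]
  else [set: S].

Definition Orb (x0 : S) : set S :=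
  [set x | exists n m : nat, [/\ iter_dom n x, iter_dom m x0 &
                                 iter n (@sigma S) x = iter m (@sigma S) x0]].

Definition fiber (x : S) : set S := [set y | dom y /\ sigma y = x].

Definition C0 : set (S -> C R) :=
  [set f | continuous f /\
    forall e : C R, 0 < e -> compact [set x | e <= `|f x|]].

(* C_c(V) for V open, each function being extended by 0 to the whole space. *)
Definition Cc (V : set S) : set (S -> C R) :=
  [set xi | [/\ continuous xi, compact (closure [set x | xi x != 0]) &
                closure [set x | xi x != 0] `<=` V]].

(* For xi in Cc dom the sum has finitely many nonzero terms. *)
Definition Cc_inner (xi eta : S -> C R) : S -> C R :=
  fun x => \sum_(y \in fiber x) ((xi y)^* * eta y).

(* Only the values of t0 on C0 and of t1 on Cc dom are meaningful. *)
Record sgds_pair (A : cstarAlgType R) (t0 t1 : (S -> C R) -> A) : Prop := {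
  t0_linear : forall (k : C R) (f g : S -> C R), C0 f -> C0 g ->
    t0 (fun x => k * f x + g x) = k *: t0 f + t0 g ;
  t0_mul : forall f g : S -> C R, C0 f -> C0 g ->
    t0 (fun x => f x * g x) = cmul (t0 f) (t0 g) ;
  t0_star : forall f : S -> C R, C0 f ->
    t0 (fun x => (f x)^*) = star (t0 f) ;
  t1_linear : forall (k : C R) (xi eta : S -> C R),
    Cc (@dom S) xi -> Cc (@dom S) eta ->
    t1 (fun x => k * xi x + eta x) = k *: t1 xi + t1 eta ;
  t1_star_t1 : forall xi eta : S -> C R,
    Cc (@dom S) xi -> Cc (@dom S) eta ->
    cmul (star (t1 xi)) (t1 eta) = t0 (Cc_inner xi eta) ;
  t1_t1_star : forall (V : set S) (xi eta : S -> C R),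
    open V -> V `<=` @dom S ->
    (forall y z, V y -> V z -> sigma y = sigma z -> y = z) ->
    Cc V xi -> Cc V eta ->
    cmul (t1 xi) (star (t1 eta)) = t0 (fun x => xi x * (eta x)^*)
}.

(* (A, t0, t1) is the C*-algebra of S with its canonical maps; the universal
   property determines it up to a unique isomorphism. *)
Record is_sgds_algebra (A : cstarAlgType R) (t0 t1 : (S -> C R) -> A) : Prop := {
  universal_pair : sgds_pair t0 t1 ;
  universal_generated : generated_by (t0 @` C0 `|` t1 @` Cc (@dom S)) ;
  universal_property : forall (B : cstarAlgType R) (s0 s1 : (S -> C R) -> B),
    sgds_pair s0 s1 ->
    exists phi : A -> B, [/\ star_morphism phi,
      forall f, C0 f -> phi (t0 f) = s0 f &
      forall xi, Cc (@dom S) xi -> phi (t1 xi) = s1 xi]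
}.

(* pi is the representation attached to (x0, gamma0), on a Hilbert space H with
   orthonormal basis delta indexed by Orb x0. *)
Record is_orbit_representation (A : cstarAlgType R) (t0 t1 : (S -> C R) -> A)
    (x0 : S) (gamma0 : C R) (H : hilbertType R) (delta : S -> H)
    (pi : A -> {linear H -> H}) : Prop := {
  orbit_rep_star : star_representation pi ;
  orbit_rep_t0 : forall (f : S -> C R) (x : S), C0 f -> Orb x0 x ->
    pi (t0 f) (delta x) = f x *: delta x ;
  orbit_rep_t1 : forall (xi : S -> C R) (x : S),
    Cc (@dom S) xi -> Orb x0 x ->
    pi (t1 xi) (delta x) =
      gamma0 *: \sum_(y \in fiber x) (xi y *: delta y)
}.

End SGDSTheory.

(* Main.v *)
(** Let W be a closed invariant subspace and w a nonzero vector of W. Some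
    coefficient of w at a basis vector delta_x is nonzero. If f is a bump
    function with f(x) = 1 that vanishes at the finitely many other points on
    which a good finite approximation of w is supported, then pi(t0 f) w is
    close to <w, delta_x> delta_x, because pi(t0 f) is a contraction; hence
    delta_x lies in W. For a bump function xi supported where sigma is injective
    with xi(y) = 1, pi(t1 xi) and its adjoint exchange delta_(sigma y) and
    delta_y up to unimodular scalars, so delta_y lies in W iff delta_(sigma y)
    does. As these moves connect any two points of the orbit, W contains every
    basis vector. *)
Require Import Defs.
From HB Require Import structures.
From mathcomp Require Import all_boot all_order all_algebra.
From mathcomp Require Import complex.
From mathcomp Require Import all_classical all_reals all_analysis.
Import Order.TTheory GRing.Theory Num.Theory.
Import numFieldNormedType.Exports.
Local Open Scope classical_set_scope.
Local Open Scope ring_scope.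

Set Implicit Arguments.
Unset Strict Implicit.
Unset Printing Implicit Defensive.

(** * Bump functions on a locally compact Hausdorff space *)

Lemma continuous_real_complex (R : realType) (T : topologicalType) (h : T -> R) :
  continuous h -> continuous (fun y => real_complex R (h y) : C R).
Proof.
move=> ch y; apply/cvgrPdist_lt => e e0.
(* In the order of the complex numbers, positivity forces the imaginary part to vanish. *)
have [eIm eRe] : e = real_complex R (complex.Re e) /\ 0 < complex.Re e.
  move: e0; case: e => a b; rewrite ltcE /= => /andP[/eqP-> a0]; split => //.
have /cvgrPdist_lt/(_ _ eRe) := ch y.
apply: filterS => z hz.
rewrite eIm -rmorphB normc_def /= expr0n /= addr0 sqrtr_sqr.
by rewrite ltcR.
Qed.

(** Complete regularity separates [x] from the complement of [V] intersected with the interior of a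
    compact neighbourhood [K]; staying inside [K] is what makes the support compact. *)
Lemma bump_function (R : realType) (S : sgds) (V : set S) (x : S) :
  open V -> V x ->
  exists f : S -> C R, [/\ C0 f, Cc V f, f x = 1,
    forall y, `|f y| <= 1 & forall y, ~ V y -> f y = 0].
Proof.
move=> oV Vx.
have [K + [cK clK]] := @space_locally_compact S x I.
rewrite withinET => xK.
have oB : open (V `&` K°) by apply: openI => //; exact: open_interior.
have crS := @locally_compact_completely_regular S R (@space_locally_compact S)
  (@space_hausdorff S).
have nBx : ~ (~` (V `&` K°)) x by apply.
have [uT hu] := crS _ _ (open_closedC oB) nBx.
have /(@uniform_separatorP _ R) [g [cg g01 gx gB]] :
  uniform_separator [set x] (~` (V `&` K°)) by exists uT.
have gx0 : g x = 0 by apply: gx; exists x.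
have gB1 y : ~ (V `&` K°) y -> g y = 1 by move=> By; apply: gB; exists y.
have g0 y : 0 <= g y by have := g01 (g y) (ex_intro2 _ _ y I erefl); rewrite /= in_itv /= => /andP[].
(* Truncating 1 - 2g moves the closed support of h into {g <= 1/2}, inside V. *)
pose h y := Num.max 0 (1 - 2 * g y).
have ch : continuous h.
  move=> y; apply: (@continuous_max R S (fun=> 0) (fun y => 1 - 2 * g y)).
    exact: cvg_cst.
  apply: cvgB; first exact: cvg_cst.
  by apply: cvgM; [exact: cvg_cst|exact: cg].
pose f y := real_complex R (h y) : C R.
have cf : continuous f by exact: continuous_real_complex.
have h0 y : 0 <= h y by rewrite /h le_max lexx.
have h1 y : h y <= 1 by rewrite /h ge_max ler01 /= lerBlDr lerDl mulr_ge0.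
have nf y : `|f y| = real_complex R (h y).
  by rewrite ger0_norm // lecR.
have hB y : h y != 0 -> g y <= 1/2.
  move=> hy; rewrite leNgt; apply/negP => gy; move/negP: hy; apply.
  apply/eqP/max_idPl; rewrite subr_le0.
  rewrite -(@ler_pdivrMl _ 2) // mulr1 ltW //.
  by rewrite -div1r.
pose F := g @^-1` [set r | r <= 1/2].
have clF : closed F by apply: preimage_closed => [y _|]; [exact: cg|exact: closed_le].
have FB y : F y -> (V `&` K°) y.
  move=> Fy; apply: contrapT => /gB1 gy.
  by move: Fy; rewrite /F /= gy; apply/negP; rewrite -ltNge ltr_pdivrMr // mul1r ltr1n.
have suppF : closure [set y | f y != 0] `<=` F.
  rewrite [X in _ `<=` X]((closure_id F).1 clF); apply: closure_subset => y /= fy.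
  by apply: hB; apply: contra_neq fy => hy; rewrite /f hy.
have Fc : compact F.
  by apply: (subclosed_compact clF cK) => y /FB[_] /interior_subset.
exists f; split => //.
- split=> // e e0.
  have [eIm eRe] : e = real_complex R (complex.Re e) /\ 0 < complex.Re e.
    move: e0; case: e => a b; rewrite ltcE /= => /andP[/eqP-> a0]; split => //.
  have -> : [set y | e <= `|f y|] = h @^-1` [set r | complex.Re e <= r].
    by apply/seteqP; split => y /=; rewrite nf eIm lecR.
  apply: (subclosed_compact _ Fc).
    by apply: preimage_closed => [y _|]; [exact: ch|exact: closed_ge].
  by move=> y /= ey; apply: hB; rewrite gt_eqF // (lt_le_trans eRe).
- split => //.
    by apply: (subclosed_compact _ Fc) => //; exact: closed_closure.
  by move=> y /suppF /FB [].
- by rewrite /f /h gx0 mulr0 subr0 max_r.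
- by move=> y; rewrite nf lecR.
- move=> y nVy; rewrite /f /h gB1; last by case.
  rewrite mulr1 max_l // subr_le0 ler1n //.
Qed.

(** * Orthonormal bases *)

Section HilbertSpace.
Context {R : realType} {H : hilbertType R}.
Implicit Types (u v w : H).

(** Pythagoras: the difference of the squares is the squared norm of the component of [v] orthogonal
    to [d]. *)
Lemma norm_hdot_le v d : hdot d d = 1 -> `|hdot v d| <= `|v|.
Proof.
move=> dd; rewrite -(@ler_pXn2r _ 2) ?nnegrE ?normr_ge0 //.
rewrite -(hdot_norm v) -subr_ge0.
have -> : hdot v v - `|hdot v d| ^+ 2 = `|v - hdot v d *: d| ^+ 2.
  rewrite -(hdot_norm (v - _)) linearBl !linearBr /= !linearZl_LR /= !linearZr_LR /= dd.
  have -> : hdot d v = (hdot v d)^* by rewrite hermC /= expr0 mul1r.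
  rewrite normCK mulr1 [(_^*) * _]mulrC.
  rewrite (_ : _ - (_^*) *: _ = 0) ?subr0 //.
  by rewrite mulrC; exact: subrr.
by rewrite exprn_ge0.
Qed.

Context {T : choiceType} {D : set T} {e : T -> H}.
Hypothesis eD : orthonormal_basis D e.

Lemma hdot_comb (s : seq T) (c : T -> C R) y : uniq s ->
  (forall x, x \in s -> D x) -> D y ->
  hdot (\sum_(x <- s) c x *: e x) (e y) = if y \in s then c y else 0.
Proof.
move=> us sD Dy; rewrite linear_sumlz.
rewrite (eq_big_seq (fun x => if x == y then c y else 0)); last first.
  move=> x xs; rewrite linearZl_LR /= eD.1 //; last exact: sD.
  by case: eqP => [->|_]; rewrite ?mulr1 ?mulr0.
case: ifPn => ys.
  rewrite (bigD1_seq y) //= eqxx big1 ?addr0 // => x /negbTE -> //.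
rewrite big_seq big1 // => x xs; case: eqP => // xy; by rewrite xy (negbTE ys) in xs.
Qed.

Lemma norm_comb (s : seq T) (c : T -> C R) : uniq s ->
  (forall x, x \in s -> D x) ->
  `|\sum_(x <- s) c x *: e x| ^+ 2 = \sum_(x <- s) `|c x| ^+ 2.
Proof.
move=> us sD; rewrite -hdot_norm linear_sumr big_seq [RHS]big_seq.
apply: eq_bigr => y ys; rewrite linearZr_LR /= hdot_comb ?ys; [|by []..|exact: sD].
by rewrite normCK mulrC.
Qed.

Lemma comb_dense v (N : set H) : nbhs v N -> exists (s : seq T) (c : T -> C R),
  [/\ uniq s, forall x, x \in s -> D x & N (\sum_(x <- s) c x *: e x)].
Proof.
move=> vN; have : closure (lin_span D e) v by rewrite eD.2.
move=> /(_ _ vN)[w [[s [c [sD ->]]]] Nw].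
(* The list from [lin_span] may repeat points; multiplicities are absorbed into the coefficients. *)
exists (undup s), (fun x => c x *+ count_mem x s); split.
- exact: undup_uniq.
- by move=> x; rewrite mem_undup; exact: sD.
- rewrite (_ : \sum_(x <- undup s) _ = \sum_(x <- s) c x *: e x) //.
  rewrite -[RHS]big_undup_iterop_count; apply: eq_bigr => x _.
  by rewrite -scalerMnl.
Qed.

(** Otherwise some finite combination [u] lies at distance less than the norm of [v] from [v]. But
    [u] is orthogonal to [v], so Pythagoras makes that distance at least the norm of [v]. *)
Lemma hdot_basis_eq0 v : (forall x, D x -> hdot v (e x) = 0) -> v = 0.
Proof.
move=> v0; apply/eqP; rewrite -normr_le0; apply/negP => /negP vn0.
have {vn0} : 0 < `|v| by rewrite normr_gt0; apply: contraNneq vn0 => ->; rewrite normr0.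
move=> vp; have [s [c [us sD]]] := comb_dense (nbhsx_ballx v _ vp).
rewrite -ball_normE /=; set u := \sum_(x <- s) _.
have uv : hdot v u = 0.
  rewrite linear_sumr big_seq big1 // => x xs.
  by rewrite linearZr_LR /= v0 ?mulr0 //; exact: sD.
move=> vu; suff : `|v| <= `|v - u| by rewrite (lt_geF vu).
rewrite -(@ler_pXn2r _ 2) ?nnegrE //.
rewrite -!hdot_norm linearBl !linearBr /= uv.
have -> : hdot u v = (hdot v u)^* by rewrite hermC /= expr0 mul1r.
by rewrite uv conjC0 subr0 sub0r opprK lerDl hdot_norm exprn_ge0.
Qed.

End HilbertSpace.

(** * Orbits of the partial map *)

Section Orbits.
Context {S : sgds}.
Implicit Types (x y : S).

(** [iter_dom] tests the last application of [sigma]; induction along an orbit has to split off the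
    first one. *)
Lemma iter_domS n x :
  iter_dom n.+1 x <-> @dom S x /\ iter_dom n (sigma x).
Proof.
elim: n => [|n IHn]; first by split=> [[]|[]].
by rewrite -[iter_dom n.+1 (sigma x)]/(_ /\ dom (iter n (@sigma S) (sigma x)))
  -[iter_dom n.+2 x]/(iter_dom n.+1 x /\ dom (iter n.+1 (@sigma S) x))
  -iterSr; rewrite IHn and_assoc.
Qed.

Lemma Orb_refl x : Orb x x.
Proof. by exists 0, 0. Qed.

Lemma Orb_sigma x y : dom y -> Orb x (sigma y) <-> Orb x y.
Proof.
move=> dy; split=> [[n [m [ny mx e]]]|[[|n] [m [ny mx e]]]].
- by exists n.+1, m; split => //; [exact/iter_domS|rewrite iterSr].
(* Here [y] is itself a forward iterate of [x], so one more step on the side of [x] reaches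
   [sigma y]. *)
- by exists 0, m.+1; split => //=; [split=> //=; rewrite -e|rewrite -e].
- by exists n, m; split => //; [have /iter_domS[] := ny|rewrite -iterSr].
Qed.

(** Each orbit point shares a forward iterate with [x], so [P] travels forward to that iterate and
    then back to [x]. *)
Lemma Orb_connected x (P : S -> Prop) :
    (forall y, dom y -> Orb x y -> P y <-> P (sigma y)) ->
  forall y z, Orb x y -> Orb x z -> P y -> P z.
Proof.
move=> Pstep.
have Piter n y : iter_dom n y -> Orb x y -> P y <-> P (iter n (@sigma S) y).
  elim: n y => [//|n IHn] y /iter_domS[dy ny] xy.
  by rewrite Pstep // iterSr IHn //; exact/Orb_sigma.
have Px y : Orb x y -> P y <-> P x.
  move=> xy; have [n [m [ny mx e]]] := xy.
  by rewrite (Piter n) // e -Piter //; exact: Orb_refl.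
by move=> y z xy xz /(Px _ xy) /(Px _ xz).
Qed.

End Orbits.

(** * The operators of the orbit representation *)

Section OrbitRepresentation.
Context {R : realType} {S : sgds} {A : cstarAlgType R} {t0 t1 : (S -> C R) -> A}.
Context {x0 : S} {gamma0 : C R} {H : hilbertType R} {delta : S -> H}.
Context (pi : A -> {linear H -> H}).
Hypothesis Hgamma0 : `|gamma0| = 1.
Hypothesis Hdelta : orthonormal_basis (Orb x0) delta.
Hypothesis Hpi : is_orbit_representation t0 t1 x0 gamma0 delta pi.

Lemma rep_t0_comb (f : S -> C R) (s : seq S) (c : S -> C R) : C0 f ->
  (forall y, y \in s -> Orb x0 y) ->
  pi (t0 f) (\sum_(y <- s) c y *: delta y) = \sum_(y <- s) (c y * f y) *: delta y.
Proof.
move=> f0 sO; rewrite linear_sum big_seq [RHS]big_seq; apply: eq_bigr => y ys.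
by rewrite linearZ /= (orbit_rep_t0 Hpi) ?scalerA //; exact: sO.
Qed.

(** On finite combinations the operator is diagonal with entries of modulus at most 1; continuity
    and density carry the bound to all vectors. *)
Lemma rep_t0_contractive (f : S -> C R) (v : H) : C0 f ->
  (forall y, `|f y| <= 1) -> `|pi (t0 f) v| <= `|v|.
Proof.
move=> f0 f1; apply/ler_addgt0Pr => e e0.
have e20 : 0 < e / 2 by rewrite divr_gt0.
have cpi : continuous (pi (t0 f)) by exact: rep_bounded (orbit_rep_star Hpi) _.
have [s [c [us sD]]] := comb_dense Hdelta (filterI (nbhsx_ballx v _ e20)
  (cpi v _ (nbhsx_ballx (pi (t0 f) v) _ e20))).
set u := \sum_(y <- s) _ => -[] /=; rewrite -!ball_normE /= => vu Tvu.
have Tu : `|pi (t0 f) u| <= `|u|.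
  rewrite -(@ler_pXn2r _ 2) ?nnegrE // rep_t0_comb // !(norm_comb Hdelta) //.
  apply: ler_sum => y _; rewrite normrM exprMn ler_piMr ?exprn_ge0 //.
  by rewrite exprn_ile1.
have -> : `|v| + e = e / 2 + (`|v| + e / 2) by rewrite addrCA -splitr.
rewrite -[pi (t0 f) v](subrK (pi (t0 f) u)).
rewrite (le_trans (ler_normD _ _)) // lerD ?(ltW Tvu) // (le_trans Tu) //.
rewrite -[u](subrK v) addrC (le_trans (ler_normD _ _)) // lerD2l distrC.
exact: ltW.
Qed.

Lemma fiber_sum (V : set S) (xi : S -> C R) (y : S) :
    (forall u v, V u -> V v -> sigma u = sigma v -> u = v) ->
    (forall u, ~ V u -> xi u = 0) -> dom y -> V y ->
  \sum_(u \in fiber (sigma y)) (xi u *: delta u) = xi y *: delta y.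
Proof.
move=> Vinj xi0 dy Vy.
rewrite -(fsbig_widen [set y]) ?fsbig_set1 //; first by move=> _ ->.
move=> u [[_ uy] nuy] /=; rewrite xi0 ?scale0r // => Vu; apply: nuy.
exact: Vinj.
Qed.

(** The adjoint is computed by pairing both sides with every basis vector [delta z]. *)
Lemma rep_star_t1 (V : set S) (xi : S -> C R) (y : S) :
    (forall u v, V u -> V v -> sigma u = sigma v -> u = v) ->
    (forall u, ~ V u -> xi u = 0) -> Cc (@dom S) xi ->
    dom y -> V y -> Orb x0 y ->
  pi (star (t1 xi)) (delta y) = (gamma0 * xi y)^* *: delta (sigma y).
Proof.
move=> Vinj xi0 xic dy Vy xy.
have xsy : Orb x0 (sigma y) by exact/Orb_sigma.
apply/subr0_eq; apply: (hdot_basis_eq0 Hdelta) => z xz.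
rewrite linearBl /= linearZl_LR /= (rep_star (orbit_rep_star Hpi)).
rewrite (orbit_rep_t1 Hpi) // linearZr_LR /= Hdelta.1 //.
have [<-|nyz] := eqVneq (sigma y) z.
  rewrite (fiber_sum Vinj) // linearZr_LR /= Hdelta.1 // eqxx.
  by rewrite !mulr1 rmorphM subrr.
rewrite mulr0 subr0.
(* For [z] other than [sigma y], the fiber sum is either a multiple of some [delta u] with [u]
   different from [y], or zero. *)
have [[u [[du uz] Vu]]|nV] := pselect (exists u, fiber z u /\ V u).
  rewrite -uz (fiber_sum Vinj) // linearZr_LR /= Hdelta.1 //; last first.
    by apply/Orb_sigma; rewrite ?uz.
  case: eqP => [yu|_]; last by rewrite !mulr0.
  by rewrite yu uz eqxx in nyz.
rewrite fsbig1 ?linear0r ?mulr0 // => u uz.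
by rewrite xi0 ?scale0r // => Vu; apply: nV; exists u.
Qed.

Lemma sigma_bump (y : S) : dom y -> exists (V : set S) (xi : S -> C R),
  [/\ forall u v, V u -> V v -> sigma u = sigma v -> u = v,
      forall u, ~ V u -> xi u = 0, Cc (@dom S) xi, V y & xi y = 1].
Proof.
move=> dy; have [V [g [[oV Vy] Vdom _ _ gK]]] := sigma_local_homeo dy.
have [xi [_ [xic xicp xiV] xiy _ xi0]] := bump_function R oV Vy.
exists V, xi; split => //.
- by move=> u v Vu Vv uv; rewrite -(gK _ Vu) -(gK _ Vv) uv.
- by split=> // u /xiV /Vdom.
Qed.

(** * Closed invariant subspaces *)

Section InvariantSubspace.
Variable W : set H.
Hypotheses (Wsub : lin_subspace W) (Wclosed : closed W).
Hypothesis Winv : forall (a : A) (v : H), W v -> W (pi a v).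

Lemma lin_subspaceZ (k : C R) (v : H) : W v -> W (k *: v).
Proof. by move=> Wv; rewrite -[_ *: _]addr0; apply: Wsub.2 => //; exact: Wsub.1. Qed.

Lemma lin_subspaceZ_inv (k : C R) (v : H) : k != 0 -> W (k *: v) -> W v.
Proof. by move=> k0 /(lin_subspaceZ k^-1); rewrite scalerA mulVf // scale1r. Qed.

Lemma invariant_basis_vector (w : H) (x : S) : W w -> Orb x0 x ->
  hdot w (delta x) != 0 -> W (delta x).
Proof.
move=> Ww xx /lin_subspaceZ_inv; apply; apply: Wclosed => N.
move=> /nbhs_ballP[e /= e0 eN].
have e20 : 0 < e / 2 by rewrite divr_gt0.
have [s [c [us sD]]] := comb_dense Hdelta (nbhsx_ballx w _ e20).
set u := \sum_(y <- s) _; rewrite -ball_normE /= => wu.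
(* A finite set is closed in a Hausdorff space, so a bump function at [x] can vanish on the rest of
   the support of [u]; it then cuts [u] down to its [x]-component. *)
pose F := [set` [seq y <- s | y != x]].
have clF : closed F.
  apply: accessible_finite_set_closed.1; last exact: finite_seq.
  by apply: hausdorff_accessible; exact: space_hausdorff.
have Fx : (~` F) x by rewrite /F /= mem_filter eqxx.
have [f [f0 _ fx f1 fF]] := bump_function R (closed_openC clF) Fx.
have Tu : pi (t0 f) u = hdot u (delta x) *: delta x.
  rewrite rep_t0_comb // (hdot_comb Hdelta) //.
  have fs y : y \in s -> y != x -> f y = 0.
    by move=> ys yx; apply: fF; apply; rewrite /F /= mem_filter yx.
  case: ifPn => xs.
    rewrite (bigD1_seq x) //= fx mulr1 big_seq_cond big1 ?addr0 // => y.
    by case/andP => ys yx; rewrite fs // mulr0 scale0r.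
  rewrite scale0r big_seq big1 // => y ys; rewrite fs ?mulr0 ?scale0r //.
  by apply: contraNneq xs => <-.
exists (pi (t0 f) w); split; first exact: Winv.
apply: eN; rewrite -ball_normE /=.
have dx : hdot (delta x) (delta x) = 1 by rewrite Hdelta.1 // eqxx.
have ndx : `|delta x| = 1.
  by apply/eqP; rewrite -(@eqrXn2 _ 2) // -hdot_norm dx expr1n.
(* The error is the [x]-component of [w - u] plus the image of [u - w] under a contraction; each
   contributes at most [e / 2], the first strictly less. *)
rewrite -[_ *: _](subrK (pi (t0 f) u)) -addrA {1}Tu -scalerBl -linearBl -linearB.
rewrite (le_lt_trans (ler_normD _ _)) // [e]splitr ltr_leD //.
  by rewrite normrZ ndx mulr1 (le_lt_trans (norm_hdot_le _ dx)).
by rewrite (le_trans (rep_t0_contractive _ f0 f1)) // distrC ltW.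
Qed.

Lemma invariant_sigma (y : S) : dom y -> Orb x0 y ->
  W (delta y) <-> W (delta (sigma y)).
Proof.
move=> dy xy; have [V [xi [Vinj xi0 xic Vy xiy]]] := sigma_bump dy.
have g0 : gamma0 != 0 by rewrite -normr_eq0 Hgamma0 oner_eq0.
split=> /Winv.
  move=> /(_ (star (t1 xi))); rewrite (rep_star_t1 Vinj) // xiy mulr1.
  by apply: lin_subspaceZ_inv; rewrite conjC_eq0.
move=> /(_ (t1 xi)); rewrite (orbit_rep_t1 Hpi) //; last exact/Orb_sigma.
by rewrite (fiber_sum Vinj) // xiy scale1r; exact: lin_subspaceZ_inv.
Qed.

Lemma invariant_full (w : H) : W w -> w != 0 -> W = [set: H].
Proof.
move=> Ww w0.
have [x xx wx] : exists2 x, Orb x0 x & hdot w (delta x) != 0.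
  apply: contrapT => nx; move/eqP: w0; apply.
  apply: (hdot_basis_eq0 Hdelta) => x xx; apply: contrapT => /eqP wx.
  by apply: nx; exists x.
have Wx := invariant_basis_vector Ww xx wx.
have Wd y : Orb x0 y -> W (delta y).
  by move=> xy; exact: (Orb_connected (P := fun y => W (delta y)) invariant_sigma xx).
apply/seteqP; split => // v _; rewrite (closure_id W).1 //.
have : closure (lin_span (Orb x0) delta) v by rewrite Hdelta.2.
apply: closure_subset => _ [s [c [sD ->]]].
rewrite big_seq; apply: (big_ind W); first exact: Wsub.1.
  by move=> u u' Wu Wu'; rewrite -[u]scale1r; exact: Wsub.2.
by move=> y ys; apply: lin_subspaceZ; apply: Wd; exact: sD.
Qed.

End InvariantSubspace.

End OrbitRepresentation.

Theorem proposition2p10 (R : realType) (S : sgds)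
    (A : cstarAlgType R) (t0 t1 : (S -> C R) -> A)
    (HA : is_sgds_algebra t0 t1)
    (x0 : S) (gamma0 : C R) (Hgamma0 : `|gamma0| = 1)
    (H : hilbertType R) (delta : S -> H)
    (Hdelta : orthonormal_basis (Orb x0) delta)
    (pi : A -> {linear H -> H})
    (Hpi : is_orbit_representation t0 t1 x0 gamma0 delta pi) :
  irreducible pi.
Proof.
split.
  (* Nondegeneracy: a bump function equal to 1 at [x0] fixes the unit vector [delta x0]. *)
  have [f [f0 _ fx _ _]] := bump_function R (@openT S) (I : [set: S] x0).
  exists (t0 f), (delta x0); rewrite (orbit_rep_t0 Hpi) //; last exact: Orb_refl.
  rewrite fx scale1r => d0; have := Hdelta.1 x0 x0 (Orb_refl _) (Orb_refl _).
  by rewrite d0 linear0r eqxx => /esym/eqP; rewrite oner_eq0.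
move=> W Wsub Wclosed Winv.
have [[w [Ww w0]]|W0] := pselect (exists w, W w /\ w != 0).
  by right; exact: (invariant_full Hgamma0 Hdelta Hpi Wsub Wclosed Winv Ww w0).
left; apply/seteqP; split=> [w Ww|_ ->]; last exact: Wsub.1.
by apply: contrapT => /eqP w0; apply: W0; exists w.
Qed.
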